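(* Let $(X,\mathbf R)$ be a symmetric association scheme with $D$ classes, cometric with respect to $E_0,\dots,E_D$. Fix $x\in X$, let $T=T(x)$, let $\chi\in V$ be a code and set $\delta^*=\delta^*(\chi)$. Suppose $t\in\{1,\dots,D\}$ is such that $$|\{i\in W_s: E_i^*(x)\chi\ne0\}|\le \delta^*-r^*(W)$$ for every irreducible $T$-module $W\subseteq V$ with $1\le r^*(W)\le t$. If every irreducible $T$-module in $V$ with dual endpoint at most $t$ is dual thin, then $F\chi$ is a relative $t$-design with respect to $x$ for every $F\in T$.
   Context: $(X,\mathbf R)$ is a symmetric association scheme with associate matrices $A_0=I,\dots,A_D$, Bose–Mesner algebra $M$, primitive idempotents $E_0=|X|^{-1}J,\dots,E_D$; cometric means each $E_j$ is a polynomial of degree exactly $j$ in $E_1$ under entrywise multiplication. $V=\mathbb C^X$ with standard basis $\{\hat y\}$ and standard Hermitian inner product. $E_i^*(x)$ is diagonal with $(E_i^*(x))_{yy}=(A_i)_{xy}$; $A_i^*(x)$ is diagonal with $(A_i^*(x))_{yy}=|X|(E_i)_{xy}$; $T(x)$ is generated by $M$ and the $A_i^*(x)$. For an irreducible $T(x)$-module $W$: support $W_s=\{i:E_i^*(x)W\ne0\}$, dual endpoint $r^*(W)=\min\{j:E_jW\neq0\}$, dual thin means $\dim E_jW\le1$ for all $j$. A code is a vector $\chi\notin E_0V$ with $\chi\notin E_0^*(z)V$ for all $z$. $\delta^*(\chi)=\min\{j\ne0:E_j\chi\ne0\}$. $\psi$ is a relative $t$-design with respect to $x$ if $E_j\psi$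 and $E_j\hat x$ are linearly dependent for all $1\le j\le t$. *)

(* Defs.v *)
(* MathComp world. Vertex set X = 'I_n, V = C^X = 'cV[algC]_n. *)
From HB Require Import structures.
From mathcomp Require Import all_boot all_order all_algebra all_field.
Set Implicit Arguments. Unset Strict Implicit. Unset Printing Implicit Defensive.
Import Order.TTheory GRing.Theory Num.Theory.
Local Open Scope ring_scope.

(* Symmetric association scheme with D classes: A_0,...,A_D. *)
Definition is_sym_assoc_scheme (n D : nat) (A : 'I_D.+1 -> 'M[algC]_n) : Prop :=
  [/\ A ord0 = 1%:M,
      \sum_(i < D.+1) A i = const_mx 1,
      (forall i y z, A i y z = 0 \/ A i y z = 1) /\ (forall i, A i != 0),
      forall i, (A i)^T = A i
    & forall i j, exists c : 'I_D.+1 -> algC, A i *m A j = \sum_(k < D.+1) c k *: A k].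

(* Membership in the Bose-Mesner algebra M = span{A_i}. *)
Definition in_BM (n D : nat) (A : 'I_D.+1 -> 'M[algC]_n) (M : 'M[algC]_n) : Prop :=
  exists c : 'I_D.+1 -> algC, M = \sum_(k < D.+1) c k *: A k.

(* E_0,...,E_D are the primitive idempotents of M, with E_0 = |X|^-1 J. *)
Definition is_prim_idems (n D : nat) (A E : 'I_D.+1 -> 'M[algC]_n) : Prop :=
  [/\ E ord0 = (n%:R)^-1 *: const_mx 1,
      forall i, in_BM A (E i),
      forall i j, E i *m E j = (if i == j then E i else 0),
      \sum_(i < D.+1) E i = 1%:M
    & forall i, E i != 0].

(* Entrywise (Hadamard) product and powers. *)
Definition hmul (n : nat) (M N : 'M[algC]_n) : 'M[algC]_n := map2_mx *%R M N.
Definition hpow (n : nat) (M : 'M[algC]_n) (k : nat) : 'M[algC]_n :=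
  iter k (hmul M) (const_mx 1).

(* Cometric: each E_j is a polynomial of degree exactly j in E_1 under o. *)
Definition is_cometric (n D : nat) (E : 'I_D.+1 -> 'M[algC]_n) : Prop :=
  forall j : 'I_D.+1, exists p : {poly algC},
    size p = j.+1 /\ E j = \sum_(k < size p) p`_k *: hpow (E (inord 1)) k.

(* Dual idempotents E_i^*(x) and dual adjacency matrices A_i^*(x). *)
Definition Estar (n D : nat) (A : 'I_D.+1 -> 'M[algC]_n) (x : 'I_n) (i : 'I_D.+1)
  : 'M[algC]_n := diag_mx (row x (A i)).
Definition Astar (n D : nat) (E : 'I_D.+1 -> 'M[algC]_n) (x : 'I_n) (i : 'I_D.+1)
  : 'M[algC]_n := diag_mx (n%:R *: row x (E i)).

(* The Terwilliger algebra T(x): generated by M and the A_i^*(x). *)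
Inductive inT (n D : nat) (A E : 'I_D.+1 -> 'M[algC]_n) (x : 'I_n) : 'M[algC]_n -> Prop :=
| inT_A i : inT A E x (A i)
| inT_Astar i : inT A E x (Astar E x i)
| inT_1 : inT A E x 1%:M
| inT_add F G : inT A E x F -> inT A E x G -> inT A E x (F + G)
| inT_scale (c : algC) F : inT A E x F -> inT A E x (c *: F)
| inT_mul F G : inT A E x F -> inT A E x G -> inT A E x (F *m G).

(* Subspaces of V are represented by matrices W whose row space is
   {v^T : v in W}. *)
Definition inW (n : nat) (W : 'M[algC]_n) (v : 'cV[algC]_n) : bool := (v^T <= W)%MS.
(* The subspace F W = {F v : v in W}. *)
Definition imW (n : nat) (F W : 'M[algC]_n) : 'M[algC]_n := W *m F^T.

Definition is_Tmodule (n D : nat) (A E : 'I_D.+1 -> 'M[algC]_n) (x : 'I_n)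
  (W : 'M[algC]_n) : Prop :=
  forall F, inT A E x F -> forall v, inW W v -> inW W (F *m v).

Definition irreducible_Tmodule (n D : nat) (A E : 'I_D.+1 -> 'M[algC]_n) (x : 'I_n)
  (W : 'M[algC]_n) : Prop :=
  [/\ is_Tmodule A E x W, W != 0 &
      forall U, is_Tmodule A E x U -> (U <= W)%MS -> U == 0 \/ (U == W)%MS].

(* Dual endpoint r^*(W) = min {j : E_j W <> 0}. *)
Definition rstar (n D : nat) (E : 'I_D.+1 -> 'M[algC]_n) (W : 'M[algC]_n) : nat :=
  \big[minn/D.+1]_(j < D.+1 | imW (E j) W != 0) (j : nat).

(* Support W_s. *)
Definition Wsupport (n D : nat) (A : 'I_D.+1 -> 'M[algC]_n) (x : 'I_n)
  (W : 'M[algC]_n) : {set 'I_D.+1} :=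
  [set i | imW (Estar A x i) W != 0].

Definition dual_thin (n D : nat) (E : 'I_D.+1 -> 'M[algC]_n) (W : 'M[algC]_n) : Prop :=
  forall j, (\rank (imW (E j) W) <= 1)%N.

(* A code: chi not in E_0 V and not in E_0^*(z) V for any z. *)
Definition is_code (n D : nat) (A E : 'I_D.+1 -> 'M[algC]_n) (chi : 'cV[algC]_n) : Prop :=
  ~ (exists w, chi = E ord0 *m w) /\
  forall z : 'I_n, ~ (exists w, chi = Estar A z ord0 *m w).

(* delta^*(chi) = min {j <> 0 : E_j chi <> 0}. *)
Definition deltastar (n D : nat) (E : 'I_D.+1 -> 'M[algC]_n) (chi : 'cV[algC]_n) : nat :=
  \big[minn/D.+1]_(j < D.+1 | (j != ord0) && (E j *m chi != 0)) (j : nat).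

(* Relative t-design with respect to x. *)
Definition rel_design (n D : nat) (E : 'I_D.+1 -> 'M[algC]_n) (t : nat) (x : 'I_n)
  (psi : 'cV[algC]_n) : Prop :=
  forall j : 'I_D.+1, (1 <= j <= t)%N ->
    exists a b : algC, (a != 0 \/ b != 0) /\
      a *: (E j *m psi) + b *: (E j *m delta_mx x ord0) = 0.

(* Main.v *)
Require Import Defs.
From HB Require Import structures.
From mathcomp Require Import all_boot all_order all_algebra all_field.
From mathcomp Require Import ring zify.
From Stdlib Require Import Classical.
Import Order.TTheory GRing.Theory Num.Theory.
Local Open Scope ring_scope.
Set Implicit Arguments. Unset Strict Implicit. Unset Printing Implicit Defensive.

(* Write chi = p + q with p in the primary module P = M xhat and q orthogonal to P.
   As M E_j = C E_j, every E_j F p lies on the line through E_j xhat. The complement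
   of P is a T-module annihilated by E_0; split it orthogonally into irreducible
   T-modules W. If r^*(W) > t then E_j W = 0 for j <= t. Otherwise the component u of
   chi in W vanishes: u is a combination of the E_i^*(x) u with i in W_s and
   E_i^*(x) chi <> 0, so a monic polynomial in A_1^*(x) of degree at most
   delta^* - r^*(W) kills u. But cometricity makes A_1^*(x) tridiagonal on the E_j V,
   and irreducibility with dual thinness makes it lower the lowest nonzero component
   E_k u of u, where k >= delta^* since E_h chi = 0 for 0 < h < delta^*, one level at
   a time down to r^*(W), so the leading power of that polynomial survives on u. *)

Section Subspaces.
Variable n : nat.
Implicit Types (F U W : 'M[algC]_n) (u v w : 'cV[algC]_n).

Lemma inW0 W : inW W 0.
Proof. by rewrite /inW linear0 sub0mx. Qed.

Lemma inWD W u v : inW W u -> inW W v -> inW W (u + v).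
Proof. by rewrite /inW linearD /=; exact: addmx_sub. Qed.

Lemma inWZ W c v : inW W v -> inW W (c *: v).
Proof. by rewrite /inW linearZ /=; exact: scalemx_sub. Qed.

Lemma inW_sum W (I : finType) (P : pred I) (f : I -> 'cV_n) :
  (forall i, P i -> inW W (f i)) -> inW W (\sum_(i | P i) f i).
Proof. by move=> H; apply: (big_ind (inW W)) => //; [exact: inW0 | exact: inWD]. Qed.

Lemma inWS U W v : (U <= W)%MS -> inW U v -> inW W v.
Proof. by move=> sUW /submx_trans; apply. Qed.

Lemma inW_row W i : inW W (row i W)^T.
Proof. by rewrite /inW trmxK row_sub. Qed.

Lemma inW_cap U W v : inW (U :&: W)%MS v = inW U v && inW W v.
Proof. by rewrite /inW sub_capmx. Qed.

Lemma inW_0 v : inW 0 v -> v = 0.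
Proof. by rewrite /inW submx0 => /eqP /(congr1 trmx); rewrite trmxK trmx0. Qed.

Lemma imWP F W v : reflect (exists2 w, inW W w & v = F *m w) (inW (imW F W) v).
Proof.
rewrite /inW /imW; apply: (iffP idP) => [/submxP [a ha] | [w /submxP [a ha] ->]].
  exists (a *m W)^T; first by rewrite /inW trmxK submxMl.
  by apply: trmx_inj; rewrite ha trmx_mul trmxK mulmxA.
by rewrite trmx_mul ha -mulmxA submxMl.
Qed.

Lemma imW_eq0P F W : reflect (forall w, inW W w -> F *m w = 0) (imW F W == 0).
Proof.
apply: (iffP eqP) => [imW0 w hw | h].
  by apply: inW_0; rewrite -imW0; apply/imWP; exists w.
apply/row_matrixP => i; rewrite row0 /imW row_mul.
by apply: trmx_inj; rewrite trmx_mul trmxK trmx0 h ?inW_row.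
Qed.

Lemma imW_neq0P F W : imW F W != 0 -> exists2 w, inW W w & F *m w != 0.
Proof.
move=> nz; case: (pickP (fun i => row i (imW F W) != 0)) => [i hi | none].
  exists (row i W)^T; first exact: inW_row.
  by apply: contra hi => /eqP Fw0; rewrite /imW row_mul -[row i W]trmxK -trmx_mul Fw0 trmx0.
by case/negP: nz; apply/eqP/row_matrixP => i; move/negbFE: (none i) => /eqP ->; rewrite row0.
Qed.

Lemma inW_rank1 W u v : (\rank W <= 1)%N -> inW W u -> inW W v -> u != 0 ->
  exists c, v = c *: u.
Proof.
move=> rW hu hv u0.
have ru : \rank u^T = 1%N.
  apply/eqP; rewrite eqn_leq rank_leq_row lt0n mxrank_eq0.
  by apply: contraNneq u0 => h; rewrite -[u]trmxK h trmx0.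
have sWu : (W <= u^T)%MS.
  by have [le_rk eq_rk] := mxrank_leqif_sup hu; rewrite -eq_rk eqn_leq le_rk ru.
have /submxP [a ha] := submx_trans hv sWu.
exists (a 0 0); apply: trmx_inj; rewrite ha linearZ /=.
by apply/rowP => j; rewrite !mxE big_ord1 !mxE (ord1 (0 : 'I_1)).
Qed.

Definition adjmx F : 'M[algC]_n := (map_mx Num.conj F)^T.

Lemma adjmxM F F' : adjmx (F *m F') = adjmx F' *m adjmx F.
Proof. by rewrite /adjmx map_mxM trmx_mul. Qed.

Lemma sum_normsq_eq0 p q (M : 'M[algC]_(p, q)) :
  \sum_(y < p) \sum_(z < q) `|M y z| ^+ 2 = 0 -> M = 0.
Proof.
move=> sum0; apply/matrixP => y z; rewrite mxE.
have row0 := psumr_eq0P (fun y _ => sumr_ge0 _ (fun z _ => exprn_ge0 2 (normr_ge0 (M y z)))) sum0.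
have := psumr_eq0P (fun z _ => exprn_ge0 2 (normr_ge0 (M y z))) (row0 y isT) isT (i := z).
by move/eqP; rewrite expf_eq0 /= normr_eq0 => /eqP.
Qed.

Lemma mxtrace_mul_adjmx F :
  \tr (F *m adjmx F) = \sum_(y < n) \sum_(z < n) `|F y z| ^+ 2.
Proof.
apply: eq_bigr => y _; rewrite mxE; apply: eq_bigr => z _.
by rewrite !mxE normCK.
Qed.

Definition dot u v : algC := (u^T *m map_mx Num.conj v) 0 0.

Definition orth W : 'M[algC]_n := kermx (map_mx Num.conj W)^T.

Lemma dotC u v : dot v u = (dot u v)^*.
Proof.
rewrite /dot !mxE rmorph_sum; apply: eq_bigr => j _.
by rewrite !mxE rmorphM /= conjCK mulrC.
Qed.

Lemma dot_eq0 v : dot v v = 0 -> v = 0.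
Proof.
move=> vv0; apply: sum_normsq_eq0; rewrite -[RHS]vv0 /dot mxE.
by apply: eq_bigr => y _; rewrite big_ord1 !mxE normCK (ord1 (0 : 'I_1)).
Qed.

Lemma dot_mull F v w : dot (F *m v) w = dot v (adjmx F *m w).
Proof.
rewrite /dot /adjmx trmx_mul map_mxM.
have -> : map_mx Num.conj (map_mx Num.conj F)^T = F^T.
  by apply/matrixP => a b; rewrite !mxE conjCK.
by rewrite !mulmxA.
Qed.

Lemma orthP W v : reflect (forall w, inW W w -> dot v w = 0) (inW (orth W) v).
Proof.
rewrite /inW /orth sub_kermx; apply: (iffP eqP) => [h w /submxP [a ha] | h].
  rewrite /dot -[w]trmxK ha.
  have -> : map_mx Num.conj (a *m W)^T = (map_mx Num.conj (a *m W))^T.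
    by apply/matrixP => i j; rewrite !mxE.
  by rewrite map_mxM trmx_mul mulmxA h mul0mx mxE.
apply/rowP => i; rewrite !mxE -[RHS](h _ (inW_row W i)) /dot mxE.
by apply: eq_bigr => j _; rewrite !mxE.
Qed.

Lemma orth_cap v W : inW W v -> inW (orth W) v -> v = 0.
Proof. by move=> hv /orthP h; apply: dot_eq0; apply: h. Qed.

Lemma orthS U W v : (U <= W)%MS -> inW (orth W) v -> inW (orth U) v.
Proof. by move=> sUW /orthP h; apply/orthP => w /(inWS sUW); apply: h. Qed.

Lemma orth_orth W v : inW W v -> inW (orth (orth W)) v.
Proof. by move=> hv; apply/orthP => w /orthP hw; rewrite dotC hw // rmorph0. Qed.

Lemma orth_decomp W v :
  exists w w', [/\ inW W w, inW (orth W) w' & v = w + w'].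
Proof.
have capW0 : (W :&: orth W)%MS = 0.
  apply/row_matrixP => i; rewrite row0; apply: trmx_inj; rewrite trmx0.
  have := row_sub i (W :&: orth W)%MS; rewrite sub_capmx => /andP [h1 h2].
  by apply: (orth_cap (W := W)); rewrite /inW trmxK.
have rk_orth : \rank (orth W) = (n - \rank W)%N.
  by rewrite /orth mxrank_ker mxrank_tr mxrank_map.
have full : row_full (W + orth W)%MS.
  by rewrite /row_full (mxrank_disjoint_sum capW0) rk_orth subnKC ?rank_leq_col.
have /sub_addsmxP [[a b] /= hab] := submx_full v^T full.
exists (a *m W)^T, (b *m orth W)^T; split; rewrite /inW ?trmxK ?submxMl //.
by rewrite -linearD /= -hab trmxK.
Qed.

Lemma proj_split U W chi u : (U <= W)%MS -> inW W u -> inW (orth W) (chi - u) ->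
  exists u1 u2, [/\ inW U u1, inW (orth U) (chi - u1),
    inW (W :&: orth U)%MS u2, inW (orth (W :&: orth U)%MS) (chi - u2) & u = u1 + u2].
Proof.
move=> sUW hu hcu; have [u1 [u2 [hu1 hu2 def_u]]] := orth_decomp U u.
rewrite def_u in hu hcu; exists u1, u2; split => //.
- have -> : chi - u1 = chi - (u1 + u2) + u2 by rewrite opprD addrA subrK.
  by apply: inWD => //; exact: orthS hcu.
- rewrite inW_cap hu2 andbT -(addKr u1 u2) -scaleN1r.
  by apply: inWD => //; apply: inWZ; exact: inWS sUW hu1.
- have -> : chi - u2 = chi - (u1 + u2) + u1 by rewrite opprD addrA addrAC subrK.
  apply: inWD; first by apply: orthS hcu; exact: capmxSl.
  by apply/orthP => w; rewrite inW_cap => /andP [_ /orthP w_orth]; rewrite dotC w_orth // rmorph0.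
Qed.

Lemma mxrank_cap_orth_lt U W : (U <= W)%MS -> U != 0 -> (\rank (W :&: orth U) < \rank W)%N.
Proof.
move=> sUW U_neq0; apply: rank_ltmx; rewrite ltmxEneq capmxSl /=.
move: U_neq0; apply: contraNN => sW_cap; apply/eqP/row_matrixP => i.
rewrite row0; apply: trmx_inj; rewrite trmx0; apply: (orth_cap (W := U)); first exact: inW_row.
by have := inWS sW_cap (inWS sUW (inW_row U i)); rewrite inW_cap => /andP [].
Qed.

End Subspaces.

Section BoseMesner.
Variables (n D : nat) (A : 'I_D.+1 -> 'M[algC]_n).
Hypothesis schemeA : is_sym_assoc_scheme A.
Local Notation BM := (in_BM A).
Implicit Types M N : 'M[algC]_n.

Lemma in_BM0 : BM 0.
Proof. by exists (fun _ => 0); rewrite big1 // => k _; rewrite scale0r. Qed.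

Lemma in_BMD M N : BM M -> BM N -> BM (M + N).
Proof.
move=> [c ->] [d ->]; exists (fun k => c k + d k).
by rewrite -big_split /=; apply: eq_bigr => k _; rewrite scalerDl.
Qed.

Lemma in_BMZ a M : BM M -> BM (a *: M).
Proof.
move=> [c ->]; exists (fun k => a * c k).
by rewrite scaler_sumr; apply: eq_bigr => k _; rewrite scalerA.
Qed.

Lemma in_BM_sum (I : finType) (P : pred I) (f : I -> 'M_n) :
  (forall i, P i -> BM (f i)) -> BM (\sum_(i | P i) f i).
Proof. by move=> H; apply: (big_ind BM) => //; [exact: in_BM0 | exact: in_BMD]. Qed.

Lemma in_BMA i : BM (A i).
Proof.
exists (fun k => (k == i)%:R); rewrite (bigD1 i) //= eqxx scale1r big1 ?addr0 //.
by move=> k /negbTE ->; rewrite scale0r.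
Qed.

Lemma in_BMM M N : BM M -> BM N -> BM (M *m N).
Proof.
move=> [c ->] [d ->]; rewrite mulmx_suml; apply: in_BM_sum => k _.
rewrite mulmx_sumr; apply: in_BM_sum => l _.
rewrite -scalemxAl -scalemxAr; apply: in_BMZ; apply: in_BMZ.
by have [_ _ _ _ closedA] := schemeA; have [e ->] := closedA k l; exists e.
Qed.

Lemma tr_A i : (A i)^T = A i.
Proof. by have [_ _ _ symA _] := schemeA. Qed.

Lemma in_BM_tr M : BM M -> M^T = M.
Proof.
move=> [c ->]; rewrite raddf_sum; apply: eq_bigr => k _.
by apply/matrixP => a b; rewrite !mxE -[in RHS]tr_A mxE.
Qed.

Lemma in_BM_comm M N : BM M -> BM N -> M *m N = N *m M.
Proof.
move=> BMM BMN; rewrite -(in_BM_tr (in_BMM BMM BMN)) trmx_mul.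
by rewrite (in_BM_tr BMM) (in_BM_tr BMN).
Qed.

Lemma A_entry01 i y z : A i y z = 0 \/ A i y z = 1.
Proof. by have [_ _ [? _] _ _] := schemeA. Qed.

Lemma sum_A_entry y z : \sum_i A i y z = 1.
Proof.
by have [_ sumA _ _ _] := schemeA; have := congr1 (fun M => M y z) sumA; rewrite /= summxE mxE.
Qed.

Lemma A_entry_ge0 i y z : 0 <= A i y z.
Proof. by case: (A_entry01 i y z) => ->. Qed.

Lemma A_entry_disj i k y z : i != k -> A i y z * A k y z = 0.
Proof.
move=> neq_ik; case: (A_entry01 i y z) => Ai; first by rewrite Ai mul0r.
case: (A_entry01 k y z) => Ak; first by rewrite Ak mulr0.
have := sum_A_entry y z; rewrite (bigD1 i) //= (bigD1 k) 1?eq_sym //= Ai Ak => sum1.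
have : 1 + 1 <= (1 : algC).
  by rewrite -{3}sum1 addrA lerDl sumr_ge0 // => j _; exact: A_entry_ge0.
by rewrite -[X in _ <= X]addr0 lerD2l ler10.
Qed.

Lemma conj_A i : map_mx Num.conj (A i) = A i.
Proof.
by apply/matrixP => y z; rewrite mxE; case: (A_entry01 i y z) => ->; rewrite ?rmorph0 ?rmorph1.
Qed.

Lemma in_BM_conj M : BM M -> BM (map_mx Num.conj M).
Proof.
move=> [c ->]; exists (fun k => (c k)^*).
apply/matrixP => y z; rewrite mxE !summxE rmorph_sum; apply: eq_bigr => k _.
by rewrite !mxE rmorphM /= -[in RHS]conj_A mxE.
Qed.

Lemma scheme_size_gt0 : (0 < n)%N.
Proof.
have [_ _ [_ A_neq0] _ _] := schemeA; move: (A_neq0 ord0).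
by case: (n) A => // A'; rewrite (flatmx0 (A' ord0)) eqxx.
Qed.

Variable E : 'I_D.+1 -> 'M[algC]_n.
Hypothesis idemE : is_prim_idems A E.

Lemma in_BM_E i : BM (E i). Proof. by have [_ ? _ _ _] := idemE. Qed.
Lemma E_neq0 i : E i != 0. Proof. by have [_ _ _ _ ?] := idemE. Qed.
Lemma sum_E : \sum_(i < D.+1) E i = 1%:M. Proof. by have [_ _ _ ? _] := idemE. Qed.
Lemma E_idem i : E i *m E i = E i.
Proof. by have [_ _ mulE _ _] := idemE; rewrite mulE eqxx. Qed.
Lemma E_orth i j : i != j -> E i *m E j = 0.
Proof. by have [_ _ mulE _ _] := idemE; rewrite mulE => /negbTE ->. Qed.

Lemma tr_E i : (E i)^T = E i. Proof. exact: in_BM_tr (in_BM_E i). Qed.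

Lemma E_mul_sum i (c : 'I_D.+1 -> algC) : E i *m (\sum_k c k *: E k) = c i *: E i.
Proof.
rewrite mulmx_sumr (bigD1 i) //= -scalemxAr E_idem big1 ?addr0 //.
by move=> k neq_ki; rewrite -scalemxAr E_orth ?scaler0 // eq_sym.
Qed.

Local Definition A_rows : 'M[algC]_(D.+1, n * n) := \matrix_k mxvec (A k).
Local Definition E_rows : 'M[algC]_(D.+1, n * n) := \matrix_k mxvec (E k).

Lemma in_BM_rows M : BM M -> (mxvec M <= A_rows)%MS.
Proof.
move=> [c ->]; rewrite linear_sum /=; apply: summx_sub => k _.
by rewrite linearZ /=; apply: scalemx_sub; apply: (eq_row_sub k); rewrite rowK.
Qed.

Lemma row_free_E_rows : row_free E_rows.
Proof.
apply: inj_row_free => v v0.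
have sum0 : \sum_k v 0 k *: E k = 0.
  apply: (can_inj mxvecK); rewrite linear_sum /= linear0 -[RHS]v0 mulmx_sum_row.
  by apply: eq_bigr => k _; rewrite rowK linearZ.
apply/rowP => k; rewrite mxE; apply/eqP.
have := E_mul_sum k (v 0); rewrite sum0 mulmx0 => /esym/eqP.
by rewrite scalemx_eq0 (negbTE (E_neq0 k)) orbF.
Qed.

(* The E_k are D+1 independent vectors of BM, which is spanned by the D+1 matrices A_k. *)
Lemma in_BM_Ebasis M : BM M -> exists c : 'I_D.+1 -> algC, M = \sum_k c k *: E k.
Proof.
have sEA : (E_rows <= A_rows)%MS.
  by apply/row_subP => k; rewrite rowK; apply: in_BM_rows; exact: in_BM_E.
have sAE : (A_rows <= E_rows)%MS.
  have [le_rk eq_rk] := mxrank_leqif_sup sEA.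
  by rewrite -eq_rk eqn_leq le_rk (eqnP row_free_E_rows) rank_leq_row.
move=> BMM; have /submxP [d Md] := submx_trans (in_BM_rows BMM) sAE; exists (d 0).
apply: (can_inj mxvecK); rewrite Md mulmx_sum_row linear_sum /=.
by apply: eq_bigr => k _; rewrite linearZ /= rowK.
Qed.

Lemma mulmx_in_BM_E M i : BM M -> exists c, M *m E i = c *: E i.
Proof.
move=> /in_BM_Ebasis [c ->]; exists (c i).
rewrite (in_BM_comm _ (in_BM_E i)) ?E_mul_sum //.
by apply: in_BM_sum => k _; apply: in_BMZ; exact: in_BM_E.
Qed.

Lemma E_mul_conj i : E i *m map_mx Num.conj (E i) = E i.
Proof.
set F := map_mx Num.conj (E i).
have BMF : BM F by apply: in_BM_conj; exact: in_BM_E.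
have FF : F *m F = F by rewrite -map_mxM E_idem.
have EF : E i *m F = F *m E i by apply: in_BM_comm => //; exact: in_BM_E.
have [c Ec] := mulmx_in_BM_E i BMF; rewrite -EF in Ec.
have c_idem : c * c = c.
  have : (c *: E i) *m (c *: E i) = c *: E i.
    by rewrite -Ec mulmxA -(mulmxA (E i) F) -EF mulmxA E_idem -mulmxA FF.
  rewrite -scalemxAl -scalemxAr E_idem scalerA => /eqP.
  by rewrite -subr_eq0 -scalerBl scalemx_eq0 (negbTE (E_neq0 i)) orbF subr_eq0 => /eqP.
(* tr (E_i conj(E_i)) is the squared Frobenius norm of the symmetric matrix E_i *)
have c_neq0 : c != 0.
  apply: contra (E_neq0 i) => /eqP c0; apply/eqP/sum_normsq_eq0.
  rewrite -mxtrace_mul_adjmx /adjmx map_trmx tr_E Ec c0 scale0r.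
  exact: mxtrace0.
by rewrite Ec -[c](mulfK c_neq0) c_idem divff // scale1r.
Qed.

Lemma conj_E i : map_mx Num.conj (E i) = E i.
Proof.
have conjK : map_mx Num.conj (map_mx Num.conj (E i)) = E i.
  by apply/matrixP => y z; rewrite !mxE conjCK.
have BMF := in_BM_conj (in_BM_E i).
have := congr1 (map_mx Num.conj) (E_mul_conj i).
by rewrite map_mxM conjK (in_BM_comm BMF (in_BM_E i)) E_mul_conj => /esym.
Qed.

Lemma adjmx_E i : adjmx (E i) = E i.
Proof. by rewrite /adjmx conj_E tr_E. Qed.

End BoseMesner.

Section Terwilliger.
Variables (n D : nat) (A E : 'I_D.+1 -> 'M[algC]_n) (x : 'I_n).
Hypothesis schemeA : is_sym_assoc_scheme A.
Hypothesis idemE : is_prim_idems A E.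
Local Notation T := (inT A E x).
Implicit Types (F M U W : 'M[algC]_n) (u v w : 'cV[algC]_n).

Lemma inT0 : T 0.
Proof. by rewrite -(scale0r 1%:M); apply: inT_scale; exact: inT_1. Qed.

Lemma inT_sum (I : finType) (P : pred I) (f : I -> 'M_n) :
  (forall i, P i -> T (f i)) -> T (\sum_(i | P i) f i).
Proof. by move=> H; apply: (big_ind T) => //; [exact: inT0 | exact: inT_add]. Qed.

Lemma in_BM_inT M : in_BM A M -> T M.
Proof. by move=> [c ->]; apply: inT_sum => k _; apply: inT_scale; exact: inT_A. Qed.

Lemma inT_E i : T (E i). Proof. exact/in_BM_inT/(in_BM_E idemE). Qed.

Lemma inT_Estar i : T (Estar A x i).
Proof.
have [a Aa] := in_BM_Ebasis idemE (in_BMA A i).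
have n_neq0 : n%:R != 0 :> algC by rewrite pnatr_eq0 -lt0n (scheme_size_gt0 schemeA).
have -> : Estar A x i = \sum_j (a j / n%:R) *: Astar E x j.
  apply/matrixP => y z; rewrite /Estar Aa summxE !mxE summxE.
  have [<-|neq_yz] := eqVneq y z; last first.
    by rewrite mulr0n big1 // => j _; rewrite !mxE (negbTE neq_yz) mulr0n mulr0.
  rewrite mulr1n; apply: eq_bigr => j _; rewrite !mxE eqxx mulr1n.
  by rewrite mulrA divfK.
by apply: inT_sum => j _; apply: inT_scale; exact: inT_Astar.
Qed.

Lemma sum_Estar : \sum_i Estar A x i = 1%:M.
Proof.
apply/matrixP => y z; rewrite summxE !mxE.
under eq_bigr do rewrite mxE.
by rewrite sumrMnl; under eq_bigr do rewrite mxE; rewrite sum_A_entry.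
Qed.

(* (E_j)_{xy} only depends on the relation i with (A_i)_{xy} = 1, as E_j is a
   combination of the A_k. *)
Lemma mulmx_Astar_Estar j : exists th : 'I_D.+1 -> algC,
  forall i, Astar E x j *m Estar A x i = th i *: Estar A x i.
Proof.
have [c Ec] := in_BM_E idemE j; exists (fun i => n%:R * c i) => i.
apply/matrixP => y z; rewrite /Astar /Estar mul_diag_mx !mxE Ec summxE.
have [_|_] := eqVneq y z; last by rewrite !mulr0n !mulr0.
rewrite !mulr1n -!mulrA; congr (_ * _).
rewrite mulr_suml (bigD1 i) //= big1 ?addr0.
  rewrite mxE -mulrA; congr (_ * _).
  by case: (A_entry01 schemeA i x y) => ->; rewrite ?mulr0 ?mulr1.
by move=> k neq_ki; rewrite mxE -mulrA (A_entry_disj schemeA _ _ neq_ki) mulr0.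
Qed.

Lemma adjmx_Astar y j : adjmx (Astar E y j) = Astar E y j.
Proof.
rewrite /adjmx /Astar map_diag_mx tr_diag_mx; congr diag_mx.
apply/rowP => a; rewrite !mxE rmorphM rmorph_nat.
by rewrite -[in RHS](conj_E schemeA idemE) !mxE.
Qed.

Lemma inT_adjmx F : T F -> T (adjmx F).
Proof.
elim=> {F} [i | i | | F G _ TF _ TG | c F _ TF | F G _ TF _ TG].
- by rewrite /adjmx conj_A // tr_A //; exact: inT_A.
- by rewrite adjmx_Astar; exact: inT_Astar.
- by rewrite /adjmx map_mx1 trmx1; exact: inT_1.
- by rewrite /adjmx map_mxD linearD /=; exact: inT_add.
- by rewrite /adjmx map_mxZ linearZ /=; exact: inT_scale.
- by rewrite adjmxM; exact: inT_mul.
Qed.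

Lemma Tmodule_orth W : is_Tmodule A E x W -> is_Tmodule A E x (orth W).
Proof.
move=> TW F TF v /orthP v_orth; apply/orthP => w hw.
by rewrite dot_mull; apply: v_orth; apply: TW => //; exact: inT_adjmx.
Qed.

Lemma Tmodule_cap U W : is_Tmodule A E x U -> is_Tmodule A E x W ->
  is_Tmodule A E x (U :&: W)%MS.
Proof.
move=> TU TW F TF v; rewrite !inW_cap => /andP [hU hW].
by rewrite TU ?TW.
Qed.

Lemma imW_Tmodule_sub F W : is_Tmodule A E x W -> T F -> (imW F W <= W)%MS.
Proof.
move=> TW TF; apply/row_subP => i; rewrite /imW row_mul.
by have := TW F TF _ (inW_row W i); rewrite /inW trmx_mul trmxK.
Qed.

End Terwilliger.

Section Cometric.
Variables (n D : nat) (A E : 'I_D.+1 -> 'M[algC]_n).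
Hypothesis schemeA : is_sym_assoc_scheme A.
Hypothesis idemE : is_prim_idems A E.
Hypothesis cometricE : is_cometric E.
Implicit Types (F M W : 'M[algC]_n) (v : 'cV[algC]_n).
Local Notation E1 := (E (inord 1)).

Lemma diag_row_hmul M N y :
  diag_mx (row y (hmul M N)) = diag_mx (row y M) *m diag_mx (row y N).
Proof.
apply/matrixP => a b; rewrite mul_diag_mx !mxE.
by case: (a == b); rewrite ?mulr1n ?mulr0n ?mulr0.
Qed.

Lemma diag_row_hpow M y k : diag_mx (row y (hpow M k)) = diag_mx (row y M) ^+ k.
Proof.
elim: k => [|k IH].
  by apply/matrixP => a b; rewrite !mxE; case: (a == b); rewrite ?mulr1n ?mulr0n.
by rewrite exprS -IH -mulmxE -diag_row_hmul.
Qed.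

Lemma Astar_poly y j : exists (q : nat -> algC) m,
  Astar E y j = \sum_(k < m) q k *: Astar E y (inord 1) ^+ k.
Proof.
have [p [_ Ep]] := cometricE j.
have n_neq0 : n%:R != 0 :> algC by rewrite pnatr_eq0 -lt0n (scheme_size_gt0 schemeA).
have A1_exp k : Astar E y (inord 1) ^+ k = n%:R ^+ k *: diag_mx (row y E1) ^+ k.
  rewrite /Astar linearZ /=; elim: k => [|k IH]; first by rewrite !expr0 scale1r.
  by rewrite !exprS IH -!mulmxE -scalemxAl -scalemxAr scalerA.
exists (fun k => p`_k * n%:R / n%:R ^+ k), (size p).
rewrite /Astar Ep linearZ !linear_sum /= scaler_sumr; apply: eq_bigr => k _.
rewrite A1_exp !linearZ /= diag_row_hpow !scalerA; congr (_ *: _).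
by rewrite [RHS]mulrC divfK ?expf_neq0.
Qed.

Lemma inW_exp W M k v :
  (forall v, inW W v -> inW W (M *m v)) -> inW W v -> inW W (M ^+ k *m v).
Proof.
move=> stabW; elim: k => [|k IH] hv; first by rewrite mul1mx.
by rewrite exprS -mulmxE -mulmxA; apply: stabW; apply: IH.
Qed.

Variable x : 'I_n.

(* By cometricity every A_j^*(x) is a polynomial in A_1^*(x). *)
Lemma Tmodule_gen W :
  (forall i v, inW W v -> inW W (A i *m v)) ->
  (forall v, inW W v -> inW W (Astar E x (inord 1) *m v)) -> is_Tmodule A E x W.
Proof.
move=> stabA stabA1 F; elim=> {F} [i | i | | F G _ TF _ TG | c F _ TF | F G _ TF _ TG] v hv.
- exact: stabA.
- have [q [m ->]] := Astar_poly x i.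
  rewrite mulmx_suml; apply: inW_sum => k _; rewrite -scalemxAl.
  by apply: inWZ; apply: inW_exp.
- by rewrite mul1mx.
- by rewrite mulmxDl; apply: inWD; [apply: TF | apply: TG].
- by rewrite -scalemxAl; apply: inWZ; apply: TF.
- by rewrite -mulmxA; apply: TF; apply: TG.
Qed.

Definition in_Espan k := in_BM (fun j : 'I_D.+1 => if (j <= k)%N then E j else 0).

Lemma in_EspanS k k' M : (k <= k')%N -> in_Espan k M -> in_Espan k' M.
Proof.
move=> le_kk' [c ->]; exists (fun j : 'I_D.+1 => if (j <= k)%N then c j else 0).
apply: eq_bigr => j _; case: ifP => [le_jk | _]; last by rewrite scaler0 scale0r.
by rewrite (leq_trans le_jk le_kk').
Qed.

Lemma in_Espan_E k (j : 'I_D.+1) : (j <= k)%N -> in_Espan k (E j).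
Proof.
move=> le_jk; exists (fun i => (i == j)%:R).
rewrite (bigD1 j) //= eqxx le_jk scale1r big1 ?addr0 //.
by move=> i /negbTE ->; rewrite scale0r.
Qed.

Lemma hpow_Espan k : (k <= D)%N -> in_Espan k (hpow E1 k).
Proof.
elim/ltn_ind: k => k IH le_kD.
have [p [size_p Ep]] := cometricE (inord k).
rewrite inordK ?ltnS // in size_p.
have pk_neq0 : p`_k != 0.
  have : lead_coef p != 0 by rewrite lead_coef_eq0 -size_poly_gt0 size_p.
  by rewrite lead_coefE size_p.
move: Ep; rewrite size_p big_ord_recr /= => Ep.
have -> : hpow E1 k = (p`_k)^-1 *: (E (inord k) - \sum_(l < k) p`_l *: hpow E1 l).
  by rewrite Ep [_ + p`_k *: _]addrC addrK scalerA mulVf ?scale1r.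
apply/in_BMZ/in_BMD; first by apply: in_Espan_E; rewrite inordK ?ltnS.
rewrite -scaleN1r; apply/in_BMZ/in_BM_sum => l _; apply: in_BMZ.
apply: (in_EspanS (ltnW (ltn_ord l))); apply: IH => //.
exact: leq_trans (ltnW (ltn_ord l)) le_kD.
Qed.

Lemma hmul_sumr M (I : finType) (f : I -> 'M_n) (c : I -> algC) :
  hmul M (\sum_i c i *: f i) = \sum_i c i *: hmul M (f i).
Proof.
apply/matrixP => a b; rewrite /hmul !mxE !summxE mulr_sumr.
by apply: eq_bigr => i _; rewrite !mxE mulrCA.
Qed.

Lemma hmul_E1_Espan (h : 'I_D.+1) : (h < D)%N -> in_Espan h.+1 (hmul E1 (E h)).
Proof.
move=> lt_hD; have [p [size_p ->]] := cometricE h.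
rewrite hmul_sumr; apply: in_BM_sum => l _; apply: in_BMZ.
have le_lh : (l.+1 <= h.+1)%N by rewrite -size_p ltn_ord.
by apply: (in_EspanS le_lh); apply: hpow_Espan; exact: leq_trans le_lh lt_hD.
Qed.

(* A_1^*(y) is diagonal with entries n (E_1)_{yz}, and
   sum_y (E_1)_{ya} (E_1)_{yb} = (E_1)_{ab} as E_1 is a symmetric idempotent. *)
Lemma sum_mxtrace_Astar (l h : 'I_D.+1) :
  let N y := E l *m Astar E y (inord 1) *m E h in
  \sum_(y < n) \tr (N y *m adjmx (N y)) = n%:R ^+ 2 * \tr (E l *m hmul E1 (E h)).
Proof.
move=> N.
have tr_N y : \tr (N y *m adjmx (N y)) =
    \sum_(a < n) \sum_(b < n) (n%:R * E1 y a) * E h a b * (n%:R * E1 y b) * E l b a.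
  set Dy := Astar E y (inord 1).
  have -> : N y *m adjmx (N y) = E l *m ((Dy *m E h *m Dy) *m E l).
    rewrite /N !adjmxM !(adjmx_E schemeA idemE) (adjmx_Astar schemeA idemE) !mulmxA.
    by rewrite -(mulmxA (E l *m Dy) (E h) (E h)) (E_idem idemE).
  rewrite mxtrace_mulC -(mulmxA _ (E l) (E l)) (E_idem idemE).
  apply: eq_bigr => a _; rewrite mxE; apply: eq_bigr => b _.
  by rewrite /Dy /Astar mul_mx_diag mul_diag_mx !mxE.
have E1_sq a b : \sum_(y < n) E1 y a * E1 y b = E1 a b.
  rewrite -[in RHS](E_idem idemE) mxE; apply: eq_bigr => y _.
  by rewrite -{1}(tr_E schemeA idemE) mxE.
rewrite (eq_bigr _ (fun y _ => tr_N y)) exchange_big.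
under eq_bigr do rewrite exchange_big.
rewrite exchange_big /mxtrace mulr_sumr; apply: eq_bigr => b _.
rewrite mxE mulr_sumr; apply: eq_bigr => a _.
rewrite /hmul mxE -(E1_sq a b) mulr_suml !mulr_sumr; apply: eq_bigr => y _; ring.
Qed.

Lemma E_Astar1_E_lower (l h : 'I_D.+1) (y : 'I_n) :
  (h.+1 < l)%N -> E l *m Astar E y (inord 1) *m E h = 0.
Proof.
move=> lt_hl; have lt_hD : (h < D)%N by have := ltn_ord l; lia.
have tr0 : \tr (E l *m hmul E1 (E h)) = 0.
  have [c ->] := hmul_E1_Espan lt_hD.
  rewrite mulmx_sumr big1 ?mxtrace0 // => j _; case: ifP => le_jh; last by rewrite scaler0 mulmx0.
  rewrite -scalemxAr (E_orth idemE) ?scaler0 //.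
  by apply: contraTneq lt_hl => ->; rewrite -leqNgt.
have := sum_mxtrace_Astar l h; rewrite /= tr0 mulr0.
have ge0 (M : 'M[algC]_n) : 0 <= \tr (M *m adjmx M).
  by rewrite mxtrace_mul_adjmx; do 2!apply: sumr_ge0 => ? _; apply: exprn_ge0.
move=> /(psumr_eq0P (fun y' _ => ge0 _))/(_ y isT).
by rewrite mxtrace_mul_adjmx => /sum_normsq_eq0.
Qed.

Lemma E_Astar1_E_upper (l h : 'I_D.+1) (y : 'I_n) :
  (l.+1 < h)%N -> E l *m Astar E y (inord 1) *m E h = 0.
Proof.
move=> lt_lh; apply: trmx_inj; rewrite trmx0 !trmx_mul !(tr_E schemeA idemE).
by rewrite /Astar tr_diag_mx mulmxA; exact: E_Astar1_E_lower.
Qed.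

End Cometric.

Lemma bigminn_le (I : finType) (P : pred I) (f : I -> nat) c j :
  P j -> (\big[minn/c]_(i | P i) f i <= f j)%N.
Proof.
move=> Pj; have : j \in index_enum I by rewrite mem_index_enum.
elim: (index_enum I) => // i r IH; rewrite inE big_cons => /predU1P [<- | jr].
  by rewrite Pj geq_minl.
by case: ifP => _; [apply: leq_trans (geq_minr _ _) (IH jr) | exact: IH].
Qed.

Lemma bigminn_mem (I : finType) (P : pred I) (f : I -> nat) c :
  \big[minn/c]_(i | P i) f i = c \/ exists2 j, P j & \big[minn/c]_(i | P i) f i = f j.
Proof.
apply: (big_ind (fun m => m = c \/ exists2 j, P j & m = f j)); [by left | | by right; exists i].
by move=> a b ha hb; rewrite /minn; case: ifP.
Qed.

Section DualEndpoint.
Variables (n D : nat) (A E : 'I_D.+1 -> 'M[algC]_n).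
Hypothesis idemE : is_prim_idems A E.
Implicit Types W : 'M[algC]_n.

Lemma rstar_le W (j : 'I_D.+1) : imW (E j) W != 0 -> (rstar E W <= j)%N.
Proof. exact: (@bigminn_le _ _ (@nat_of_ord _)). Qed.

Lemma rstar_mem W : W != 0 ->
  exists j : 'I_D.+1, j = rstar E W :> nat /\ imW (E j) W != 0.
Proof.
move=> W_neq0.
have [j Ej] : exists j : 'I_D.+1, imW (E j) W != 0.
  apply/existsP; apply: contraNT W_neq0; rewrite negb_exists => /forallP EW0.
  apply/eqP; rewrite -[W]mulmx1 -[1%:M]trmx1 -(sum_E idemE) raddf_sum mulmx_sumr /=.
  by rewrite big1 // => i _; apply/eqP; rewrite -[_ == 0]negbK EW0.
rewrite /rstar.
have [rD | [i Ei ->]] :=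
  bigminn_mem (fun j : 'I_D.+1 => imW (E j) W != 0) (@nat_of_ord _) D.+1.
  by have := rstar_le Ej; rewrite /rstar rD leqNgt ltn_ord.
by exists i.
Qed.

End DualEndpoint.

Section Vanishing.
Variables (n D : nat) (A E : 'I_D.+1 -> 'M[algC]_n) (x : 'I_n).
Hypothesis schemeA : is_sym_assoc_scheme A.
Hypothesis idemE : is_prim_idems A E.
Hypothesis cometricE : is_cometric E.
Local Notation T := (inT A E x).
Local Notation A1 := (Astar E x (inord 1)).
Local Notation Tmodule := (is_Tmodule A E x).
Local Notation irreducible := (irreducible_Tmodule A E x).
Implicit Types (F U W : 'M[algC]_n) (u v w chi : 'cV[algC]_n).

Definition Etail k : 'M[algC]_n := \sum_(h < D.+1 | (k <= h)%N) E h.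

Lemma in_BM_Etail k : in_BM A (Etail k).
Proof. by apply: in_BM_sum => h _; exact: in_BM_E idemE h. Qed.

Lemma E_mul_Etail k (j : 'I_D.+1) : E j *m Etail k = if (k <= j)%N then E j else 0.
Proof.
rewrite /Etail mulmx_sumr; case: ifP => le_kj.
  rewrite (bigD1 j) //= (E_idem idemE) // big1 ?addr0 // => h /andP [_ neq_hj].
  by rewrite (E_orth idemE) // eq_sym.
by rewrite big1 // => h le_kh; rewrite (E_orth idemE) //; apply: contraFneq le_kj => ->.
Qed.

Lemma Etail_compl k : Etail k + \sum_(h < D.+1 | (h < k)%N) E h = 1%:M.
Proof.
rewrite /Etail -(sum_E idemE) [RHS](bigID (fun h : 'I_D.+1 => (k <= h)%N)) /=.
by congr (_ + _); apply: eq_bigl => h; rewrite ltnNge.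
Qed.

(* By tridiagonality, A_1^* can only leave E_{>=k} W through E_{k-1} A_1^* E_k. *)
Lemma Tmodule_Etail W (k' k : 'I_D.+1) : Tmodule W -> k = k'.+1 :> nat ->
  imW (E k' *m A1 *m E k) W == 0 -> Tmodule (imW (Etail k) W).
Proof.
move=> TW def_k /imW_eq0P lower0; set G := Etail k.
have TG : T G by apply: in_BM_inT; exact: in_BM_Etail.
apply: (Tmodule_gen schemeA cometricE) => [i v /imWP [w hw ->] | v /imWP [w hw ->]].
  apply/imWP; exists (A i *m w); first by apply: (TW) => //; exact: inT_A.
  by rewrite !mulmxA (in_BM_comm schemeA (in_BMA A i) (in_BM_Etail k)).
apply/imWP; exists (A1 *m (G *m w)); first by apply: (TW); [exact: inT_Astar | exact: TW].
rewrite -{1}(mul1mx (A1 *m (G *m w))) -(Etail_compl k) mulmxDl -/G.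
rewrite [X in _ + X](_ : _ = 0) ?addr0 // mulmx_suml big1 // => l lt_lk.
rewrite /G /Etail mulmx_suml !mulmx_sumr big1 // => h le_kh.
have [lt_lh | le_hl] := ltnP l.+1 h.
  by rewrite !mulmxA (E_Astar1_E_upper schemeA idemE cometricE) ?mul0mx.
have -> : l = k' by apply: ord_inj; lia.
have -> : h = k by apply: ord_inj; lia.
by rewrite !mulmxA lower0.
Qed.

(* Otherwise E_{>=k} W would be a nonzero submodule missing E_{r^*} W. *)
Lemma lowering_neq0 W (k' k : 'I_D.+1) : irreducible W -> k = k'.+1 :> nat ->
  (rstar E W < k)%N -> imW (E k) W != 0 -> imW (E k' *m A1 *m E k) W != 0.
Proof.
move=> [TW W_neq0 minW] def_k lt_rk Ek_neq0; apply/negP => lower0.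
set U := imW (Etail k) W.
have TU := Tmodule_Etail TW def_k lower0.
have sUW : (U <= W)%MS by apply: imW_Tmodule_sub TW _; apply: in_BM_inT; exact: in_BM_Etail.
have U_neq0 : U != 0.
  have [w0 hw0 Ew0] := imW_neq0P Ek_neq0; apply: contraNneq Ew0 => U0.
  have : inW U (Etail k *m w0) by apply/imWP; exists w0.
  rewrite U0 => /inW_0 Gw0; apply/eqP.
  by have := congr1 (mulmx (E k)) Gw0; rewrite mulmxA E_mul_Etail leqnn mulmx0.
have [j [def_j Ej]] := rstar_mem idemE W_neq0.
have [w hw Ew] := imW_neq0P Ej.
case: (minW U TU sUW) => [U0 | /andP [_ sWU]]; first by rewrite U0 in U_neq0.
have /imWP [w' _ def_w] := inWS sWU hw.
by move: Ew; rewrite def_w mulmxA E_mul_Etail leqNgt def_j lt_rk mul0mx eqxx.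
Qed.

(* [k <= D] keeps [inord k] from wrapping around to 0. *)
Definition lowest_level v k := [/\ (k <= D)%N, E (inord k) *m v != 0 &
  forall h : 'I_D.+1, (h < k)%N -> E h *m v = 0].

Lemma lowest_level_exists v : v != 0 -> exists k, lowest_level v k.
Proof.
move=> v_neq0.
have [j Ej] : exists j : 'I_D.+1, E j *m v != 0.
  apply/existsP; apply: contraNT v_neq0; rewrite negb_exists => /forallP Ev0.
  apply/eqP; rewrite -[v]mul1mx -(sum_E idemE) mulmx_suml big1 // => h _.
  by apply/eqP; rewrite -[_ == 0]negbK Ev0.
have ex_k : exists k, (k <= D)%N && (E (inord k) *m v != 0).
  by exists j; rewrite -ltnS ltn_ord inord_val.
case: (ex_minnP ex_k) => k /andP [le_kD Ek] min_k; exists k; split => // h lt_hk.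
apply/eqP; apply: contraTT lt_hk => Eh; rewrite -leqNgt; apply: min_k.
by rewrite -ltnS ltn_ord inord_val.
Qed.

Lemma E_Astar1_expand h v : E h *m (A1 *m v) = \sum_(h' < D.+1) E h *m A1 *m E h' *m v.
Proof.
rewrite -{1}(mul1mx v) -(sum_E idemE) mulmx_suml !mulmx_sumr.
by apply: eq_bigr => h' _; rewrite !mulmxA.
Qed.

Lemma lowest_level_Astar1 W v k : irreducible W -> dual_thin E W -> inW W v ->
  (rstar E W <= k)%N -> lowest_level v k.+1 -> lowest_level (A1 *m v) k.
Proof.
move=> irrW thinW hv le_rk [lt_kD Ev low_v].
set k1 : 'I_D.+1 := inord k.+1; set k0 : 'I_D.+1 := inord k.
have val_k1 : k1 = k.+1 :> nat by rewrite inordK.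
have val_k0 : k0 = k :> nat by rewrite inordK // ltnS ltnW.
split; first exact: ltnW.
- have -> : E k0 *m (A1 *m v) = E k0 *m A1 *m E k1 *m v.
    rewrite E_Astar1_expand (bigD1 k1) //= big1 ?addr0 // => h neq_hk1.
    have [lt_hk1 | le_k1h] := ltnP h k1; first by rewrite -mulmxA low_v ?mulmx0 // -val_k1.
    rewrite (E_Astar1_E_upper schemeA idemE cometricE) ?mul0mx // val_k0.
    by move: neq_hk1 le_k1h; rewrite -val_eqE /= val_k1; lia.
  have Ek1W : imW (E k1) W != 0 by apply: contraNneq Ev => /eqP/imW_eq0P EW0; rewrite EW0.
  have def_k1 : k1 = k0.+1 :> nat by rewrite val_k1 val_k0.
  have := lowering_neq0 irrW def_k1 _ Ek1W; rewrite val_k1 ltnS => /(_ le_rk).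
  case/imW_neq0P => w hw Aw; apply/eqP => lower_v; move: Aw.
  have [c Ew] : exists c, E k1 *m w = c *: (E k1 *m v).
    by apply: inW_rank1 (thinW k1) _ _ Ev; apply/imWP; [exists v | exists w].
  by rewrite -!mulmxA Ew -!scalemxAr !mulmxA lower_v scaler0 eqxx.
- move=> h lt_hk; rewrite E_Astar1_expand big1 // => h' _.
  have [lt_h'k1 | le_k1h'] := ltnP h' k.+1; first by rewrite -mulmxA low_v ?mulmx0.
  by rewrite (E_Astar1_E_upper schemeA idemE cometricE) ?mul0mx //; lia.
Qed.

Lemma lowest_level_exp W u j : irreducible W -> dual_thin E W -> inW W u ->
  lowest_level u j -> forall l, (l <= j - rstar E W)%N ->
  inW W (A1 ^+ l *m u) /\ lowest_level (A1 ^+ l *m u) (j - l).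
Proof.
move=> irrW thinW hu low_u; have [TW _ _] := irrW.
elim=> [|l IH] le_l; first by rewrite mul1mx subn0.
have [hv low_v] := IH (ltnW le_l).
rewrite exprS -mulmxE -mulmxA; split; first by apply: (TW) => //; exact: inT_Astar.
apply: lowest_level_Astar1 irrW thinW hv _ _; first by lia.
by have -> : (j - l.+1).+1 = (j - l)%N by lia.
Qed.

Lemma exp_Astar1_Estar : exists th : 'I_D.+1 -> algC,
  forall i k v, A1 ^+ k *m (Estar A x i *m v) = th i ^+ k *: (Estar A x i *m v).
Proof.
have [th A1_Estar] := mulmx_Astar_Estar x schemeA idemE (inord 1).
exists th => i; elim=> [|k IH] v; first by rewrite mul1mx expr0 scale1r.
rewrite exprS -mulmxE -mulmxA IH -scalemxAr mulmxA A1_Estar -scalemxAl scalerA.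
by rewrite exprS mulrC.
Qed.

Lemma Astar1_annihilator (I : {set 'I_D.+1}) u :
  u = \sum_(i in I) Estar A x i *m u ->
  exists p : {poly algC}, [/\ p \is monic, size p = #|I|.+1 &
    \sum_(k < size p) p`_k *: (A1 ^+ k *m u) = 0].
Proof.
move=> def_u; have [th exp_A1] := exp_Astar1_Estar.
set p := \prod_(a <- [seq th i | i <- enum I]) ('X - a%:P).
exists p; split; first exact: monic_prod_XsubC.
  by rewrite size_prod_XsubC size_map -cardE.
rewrite def_u; under eq_bigr do rewrite mulmx_sumr scaler_sumr.
rewrite exchange_big big1 //= => i Ii.
under eq_bigr do rewrite exp_A1 scalerA.
rewrite -scaler_suml -horner_coef_wide //.
have /rootP -> : root p (th i) by rewrite root_prod_XsubC map_f ?mem_enum.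
by rewrite scale0r.
Qed.

Lemma monic_annihilator_lowest (p : {poly algC}) u j : p \is monic ->
  (size p <= j.+1)%N ->
  (forall k, (k < size p)%N -> lowest_level (A1 ^+ k *m u) (j - k)) ->
  \sum_(k < size p) p`_k *: (A1 ^+ k *m u) != 0.
Proof.
move=> monic_p le_pj low.
have [m size_p] : exists m, size p = m.+1.
  by exists (size p).-1; rewrite prednK // size_poly_gt0 monic_neq0.
have lt_mp : (m < size p)%N by rewrite size_p.
have lead_p : p`_m = 1 by move/monicP: monic_p; rewrite lead_coefE size_p.
have [le_jmD Em _] := low m lt_mp.
apply: contraNneq Em => annih; move/(congr1 (mulmx (E (inord (j - m))))): annih.
rewrite mulmx0 mulmx_sumr size_p big_ord_recr /= big1 ?add0r.
  by rewrite -scalemxAr lead_p scale1r => ->.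
move=> k _; have lt_km := ltn_ord k; have [_ _ low_k] := low k (ltn_trans lt_km lt_mp).
rewrite -scalemxAr low_k ?scaler0 // inordK; first by move: le_pj; rewrite size_p; lia.
by rewrite ltnS.
Qed.

Lemma proj_annihilated W chi u F : Tmodule W -> inW W u -> inW (orth W) (chi - u) ->
  T F -> F *m chi = 0 -> F *m u = 0.
Proof.
move=> TW hu hcu TF Fchi0; apply: (orth_cap (TW F TF u hu)).
have -> : F *m u = (-1) *: (F *m (chi - u)) by rewrite mulmxBr Fchi0 sub0r scaleN1r opprK.
by apply: inWZ; apply: (Tmodule_orth schemeA idemE TW).
Qed.

Definition Wsupport_code W chi : {set 'I_D.+1} :=
  [set i in Wsupport A x W | Estar A x i *m chi != 0].

Lemma proj_Estar_support W chi u : Tmodule W -> inW W u -> inW (orth W) (chi - u) ->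
  u = \sum_(i in Wsupport_code W chi) Estar A x i *m u.
Proof.
move=> TW hu hcu; rewrite -{1}(mul1mx u) -(sum_Estar x schemeA) mulmx_suml.
rewrite [LHS](bigID (mem (Wsupport_code W chi))) /=.
rewrite [X in _ + X]big1 ?addr0 // => i; rewrite !inE negb_and => /orP [| Echi].
  by rewrite negbK => /imW_eq0P; apply.
apply: proj_annihilated TW hu hcu (inT_Estar x schemeA idemE i) _.
by apply/eqP; rewrite -[_ == 0]negbK.
Qed.

Lemma proj_irreducible_eq0 W chi u : irreducible W -> (0 < rstar E W)%N -> dual_thin E W ->
  (#|Wsupport_code W chi| + rstar E W <= deltastar E chi)%N ->
  inW W u -> inW (orth W) (chi - u) -> u = 0.
Proof.
move=> irrW r_gt0 thinW count hu hcu; have [TW _ _] := irrW.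
apply/eqP; apply: contraT => u_neq0.
have [j low_u] := lowest_level_exists u_neq0; have [le_jD Eu _] := low_u.
have le_rj : (rstar E W <= j)%N.
  have EjW : imW (E (inord j)) W != 0 by apply: contraNneq Eu => /eqP/imW_eq0P ->.
  by have := rstar_le EjW; rewrite inordK.
have le_dj : (deltastar E chi <= j)%N.
  have Echi : E (inord j) *m chi != 0.
    by apply: contraNneq Eu => /(proj_annihilated TW hu hcu (inT_E x idemE _)) ->.
  have j_neq0 : (inord j : 'I_D.+1) != ord0 by rewrite -val_eqE /= inordK //; lia.
  rewrite -[j](@inordK D) // /deltastar.
  by apply: (@bigminn_le _ _ (@nat_of_ord _)); rewrite j_neq0.
have [p [monic_p size_p annih]] := Astar1_annihilator (proj_Estar_support TW hu hcu).
have low k : (k < size p)%N -> lowest_level (A1 ^+ k *m u) (j - k).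
  move=> lt_kp; have le_k : (k <= j - rstar E W)%N by lia.
  by have [] := lowest_level_exp irrW thinW hu low_u le_k.
by have := monic_annihilator_lowest monic_p _ low; rewrite annih eqxx; apply; lia.
Qed.

Lemma Tmodule_reducible W : Tmodule W -> W != 0 -> ~ irreducible W ->
  exists U, [/\ Tmodule U, (U <= W)%MS, U != 0 & ~~ (U == W)%MS].
Proof.
move=> TW W_neq0 redW; apply: NNPP => no_sub; apply: redW; split => // U TU sUW.
have [-> | U_neq0] := eqVneq U 0; first by left.
case eqUW : (U == W)%MS; first by right.
by case: no_sub; exists U; rewrite eqUW.
Qed.

Lemma proj_E_vanishes chi t :
  (forall W, irreducible W -> (1 <= rstar E W <= t)%N ->
     (#|Wsupport_code W chi| + rstar E W <= deltastar E chi)%N) ->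
  (forall W, irreducible W -> (rstar E W <= t)%N -> dual_thin E W) ->
  forall W u, Tmodule W -> imW (E ord0) W == 0 -> inW W u -> inW (orth W) (chi - u) ->
  forall F (j : 'I_D.+1), T F -> (1 <= j <= t)%N -> E j *m (F *m u) = 0.
Proof.
move=> count thin W; have [m] := ubnP (\rank W); elim: m W => // m IH W lt_rk.
move=> u TW E0W hu hcu F j TF /andP [j_gt0 le_jt].
have [W0 | W_neq0] := eqVneq W 0; first by rewrite W0 in hu; rewrite (inW_0 hu) !mulmx0.
have [irrW | redW] := classic (irreducible W).
  have [r [def_r Er]] := rstar_mem idemE W_neq0.
  have r_gt0 : (0 < rstar E W)%N.
    rewrite -def_r lt0n; apply: contraNneq Er => r0.
    by have -> : r = ord0 by apply: ord_inj.
  have [le_rt | lt_tr] := leqP (rstar E W) t.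
    have := count W irrW; rewrite r_gt0 le_rt => /(_ isT) count_W.
    by rewrite (proj_irreducible_eq0 irrW r_gt0 (thin W irrW le_rt) count_W hu hcu) !mulmx0.
  have /imW_eq0P EjW : imW (E j) W == 0.
    apply: contraTT lt_tr => /rstar_le le_rj; rewrite -leqNgt; exact: leq_trans le_rj le_jt.
  by apply: EjW; exact: TW F TF u hu.
have [U [TU sUW U_neq0 neq_UW]] := Tmodule_reducible TW W_neq0 redW.
have E0_sub V : (V <= W)%MS -> imW (E ord0) V == 0.
  by move=> sVW; apply/imW_eq0P => v /(inWS sVW); apply/imW_eq0P.
have [u1 [u2 [hu1 hcu1 hu2 hcu2 ->]]] := proj_split sUW hu hcu.
have tj : (1 <= j <= t)%N by rewrite j_gt0.
have lt_UW : (\rank U < \rank W)%N by apply: rank_ltmx; rewrite ltmxEneq neq_UW sUW.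
have lt_capW := mxrank_cap_orth_lt sUW U_neq0.
have TcapW : Tmodule (W :&: orth U)%MS.
  exact: (Tmodule_cap TW (Tmodule_orth schemeA idemE TU)).
rewrite !mulmxDr (IH U (leq_trans lt_UW lt_rk) u1 TU _ hu1 hcu1 F j TF tj) ?E0_sub //.
by rewrite (IH _ (leq_trans lt_capW lt_rk) u2 TcapW _ hu2 hcu2 F j TF tj) ?addr0 ?E0_sub ?capmxSl.
Qed.

End Vanishing.

Section PrimaryModule.
Variables (n D : nat) (A E : 'I_D.+1 -> 'M[algC]_n) (x : 'I_n).
Hypothesis schemeA : is_sym_assoc_scheme A.
Hypothesis idemE : is_prim_idems A E.
Hypothesis cometricE : is_cometric E.
Local Notation xhat := (delta_mx x ord0 : 'cV[algC]_n).
Implicit Types (M : 'M[algC]_n) (v w : 'cV[algC]_n).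

Definition primary_module : 'M[algC]_n := <<\matrix_k (A k *m xhat)^T>>%MS.
Local Notation P := primary_module.

Lemma in_BM_primary M : in_BM A M -> inW P (M *m xhat).
Proof.
move=> [c ->]; rewrite /inW genmxE mulmx_suml raddf_sum /=.
apply: summx_sub => k _; rewrite -scalemxAl linearZ /=; apply: scalemx_sub.
by apply: (eq_row_sub k); rewrite rowK.
Qed.

Lemma primaryP v : inW P v -> exists2 M, in_BM A M & v = M *m xhat.
Proof.
rewrite /inW genmxE => /submxP [a def_v]; exists (\sum_k a 0 k *: A k).
  by apply: in_BM_sum => k _; apply: in_BMZ; exact: in_BMA.
apply: trmx_inj; rewrite def_v mulmx_sum_row mulmx_suml raddf_sum /=.
by apply: eq_bigr => k _; rewrite rowK -scalemxAl linearZ.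
Qed.

Lemma A_mul_xhat k : A k *m xhat = Estar A x k *m const_mx 1.
Proof.
apply/matrixP => y z; rewrite -colE mul_diag_mx !mxE mulr1.
by rewrite -[in LHS](tr_A schemeA k) mxE.
Qed.

Lemma Tmodule_primary : is_Tmodule A E x P.
Proof.
have [th A1_Estar] := mulmx_Astar_Estar x schemeA idemE (inord 1).
apply: (Tmodule_gen schemeA cometricE) => [i v /primaryP [M BMM ->] | v /primaryP [M [c ->] ->]].
  by rewrite mulmxA; apply: in_BM_primary; apply: in_BMM => //; exact: in_BMA.
have -> : Astar E x (inord 1) *m ((\sum_k c k *: A k) *m xhat) =
    (\sum_k (c k * th k) *: A k) *m xhat.
  rewrite !mulmx_suml mulmx_sumr; apply: eq_bigr => k _.
  by rewrite -!scalemxAl -scalemxAr A_mul_xhat mulmxA A1_Estar -scalemxAl scalerA.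
by apply: in_BM_primary; apply: in_BM_sum => k _; apply: in_BMZ; exact: in_BMA.
Qed.

Lemma E0_primary w : inW P (E ord0 *m w).
Proof.
have [E0 _ _ _ _] := idemE; have [_ sumA _ _ _] := schemeA.
have BMJ : in_BM A (const_mx 1) by rewrite -sumA; apply: in_BM_sum => k _; exact: in_BMA.
have -> : E ord0 *m w = ((n%:R)^-1 * \sum_z w z ord0) *: const_mx 1 *m xhat.
  apply/matrixP => y z; rewrite (ord1 z) E0 -colE !mxE mulr1 mulr_sumr.
  by apply: eq_bigr => z' _; rewrite !mxE mulr1.
by apply: in_BM_primary; apply: in_BMZ.
Qed.

Lemma rel_design_mulT chi t :
  (forall W, irreducible_Tmodule A E x W -> (1 <= rstar E W <= t)%N ->
     (#|Wsupport_code A x W chi| + rstar E W <= deltastar E chi)%N) ->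
  (forall W, irreducible_Tmodule A E x W -> (rstar E W <= t)%N -> dual_thin E W) ->
  forall F, inT A E x F -> rel_design E t x (F *m chi).
Proof.
move=> count thin F TF j tj.
have [p [q [hp hq def_chi]]] := orth_decomp P chi.
have TQ := Tmodule_orth schemeA idemE Tmodule_primary.
have E0Q : imW (E ord0) (orth P) == 0.
  by apply/imW_eq0P => w hw; apply: (orth_cap (E0_primary w)); exact: TQ _ (inT_E x idemE _) _ hw.
have hcq : inW (orth (orth P)) (chi - q) by rewrite def_chi addrK; exact: orth_orth.
have Eq0 := proj_E_vanishes schemeA idemE cometricE count thin TQ E0Q hq hcq TF tj.
have [M BMM def_Fp] := primaryP (Tmodule_primary TF hp).
have [c Ec] := mulmx_in_BM_E schemeA idemE j BMM.
exists 1, (- c); split; first by left; exact: oner_neq0.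
rewrite def_chi !mulmxDr Eq0 addr0 def_Fp mulmxA (in_BM_comm schemeA (in_BM_E idemE j) BMM) Ec.
by rewrite scale1r -scalemxAl scaleNr addrN.
Qed.

End PrimaryModule.

Theorem corollary4p6 (n D : nat) (A E : 'I_D.+1 -> 'M[algC]_n) (x : 'I_n)
  (chi : 'cV[algC]_n) (t : nat) :
  is_sym_assoc_scheme A -> is_prim_idems A E -> is_cometric E ->
  is_code A E chi -> (1 <= t <= D)%N ->
  (forall W : 'M[algC]_n, irreducible_Tmodule A E x W ->
     (1 <= rstar E W <= t)%N ->
     (#|[set i in Wsupport A x W | Estar A x i *m chi != 0]|%:Z
        <= (deltastar E chi)%:Z - (rstar E W)%:Z)%R) ->
  (forall W : 'M[algC]_n, irreducible_Tmodule A E x W ->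
     (rstar E W <= t)%N -> dual_thin E W) ->
  forall F : 'M[algC]_n, inT A E x F -> rel_design E t x (F *m chi).
Proof.
move=> schemeA idemE cometricE _ _ count thin.
apply: (rel_design_mulT schemeA idemE cometricE _ thin) => W irrW rW.
by have := count W irrW rW; rewrite -/(Wsupport_code A x W chi); lia.
Qed.
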